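(* Let $(Q,\mathcal{G})$ be a Riemannian manifold, $V$ a smooth function on $Q$, $L(q,\dot q)=\frac12\mathcal{G}_{ij}\dot q^i\dot q^j-V(q)$, $f^1,\dots,f^m\in\Omega^1(Q)$ with $m<n=\dim Q$, $Y^a=\sharp_{\mathcal{G}}(f^a)$, and let $\mathcal{M}=\phi^{-1}(\{0\})\subset TQ$ be a constraint submanifold such that $T\mathcal{M}$ and $\mathcal{F}^V=\operatorname{span}\{(Y^a)^V\}$ are transversal along $\mathcal{M}$. Let $G$ be the Euler–Lagrange vector field of $L$. Then the vector field $\Gamma$ along $\mathcal{M}$ defined by $$i_\Gamma\omega_L-dE_L\in J^*\hat{\mathcal{F}}^o,\qquad \Gamma\in T\mathcal{M},$$ satisfies, at every point of $\mathcal{M}$, $$\Gamma=\mathcal{P}(G)=G-C_{ab}\,G(\phi^b)\,(Y^a)^V .$$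
   Context: All objects are smooth and summation over repeated indices is understood. $Q$ has dimension $n$, with local coordinates $q^i$; $(q^i,\dot q^i)$ are the induced coordinates on $TQ$. Constraint: $\phi=(\phi^1,\dots,\phi^m):TQ\to\mathbb{R}^m$ is smooth with $T_p\phi$ surjective for all $p\in\mathcal{M}=\phi^{-1}(\{0\})$, so $\mathcal{M}$ is a submanifold of $TQ$ of dimension $2n-m$. Lagrangian structure: $J=dq^i\otimes\frac{\partial}{\partial\dot q^i}$ and $J^*(d\varphi)=\frac{\partial\varphi}{\partial\dot q^i}dq^i$ for $\varphi\in C^\infty(TQ)$. $E_L=\dot q^i\frac{\partial L}{\partial\dot q^i}-L$; $\omega_L=-d(J^*(dL))$ is a symplectic form on $TQ$; $i_X\omega_L=\omega_L(X,\cdot)$. The Euler–Lagrange vector field $G$ is defined by $i_G\omega_L=dE_L$. Notation: $\sharp_{\mathcal{G}}$ is the inverse of $\flat_{\mathcal{G}}(X)=\mathcal{G}(X,\cdot)$. The vertical lift of $X=X^i\frac{\partial}{\partial q^i}$ is $X^V=X^i\frac{\partial}{\partial\dot q^i}$. For each $a$, $\hat f^a:TQ\to\mathbb{R}$ is the fiberwise linear function $\hat f^a(v_q)=\langle f^a(q),v_q\rangle$; $\hat{\mathcal{F}}^o=\operatorname{span}\{d\hat f^a\}$, and so $J^*\hat{\mathcal{F}}^o=\operatorname{span}\{J^*(d\hat f^a)\}$. Transversality: for every $v_q\in\mathcal{M}$, $T_{v_q}(TQ)=T_{v_q}\mathcal{M}+\mathcal{F}^V_{v_q}$ and $\dim T_{v_q}(TQ)=\dim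 T_{v_q}\mathcal{M}+\dim\mathcal{F}^V_{v_q}$. Hence $T(TQ)|_{\mathcal{M}}=\mathcal{F}^V|_{\mathcal{M}}\oplus T\mathcal{M}$. Projections: let $C^{ab}=(Y^b)^V(\phi^a)=\mathcal{G}^{ij}f^b_i\frac{\partial\phi^a}{\partial\dot q^j}$ on $\mathcal{M}$ (an invertible $m\times m$ matrix, where $f^b=f^b_idq^i$ and $(\mathcal{G}^{ij})$ is the inverse of $(\mathcal{G}_{ij})$) and let $(C_{ab})$ be its inverse matrix. The projections associated with the decomposition are $\mathcal{Q}=C_{ab}(Y^a)^V\otimes d\phi^b:T(TQ)|_{\mathcal{M}}\to\mathcal{F}^V|_{\mathcal{M}}$ and $\mathcal{P}=\mathrm{Id}-\mathcal{Q}:T(TQ)|_{\mathcal{M}}\to T\mathcal{M}$. *)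

(* Defs.v *)
From HB Require Import structures.
From mathcomp Require Import all_boot all_order all_algebra.
From mathcomp Require Import mathcomp_extra boolp classical_sets functions.
From mathcomp Require Import cardinality reals topology normedtype landau derive.
Set Implicit Arguments. Unset Strict Implicit. Unset Printing Implicit Defensive.
Import Order.TTheory GRing.Theory Num.Theory.
Import numFieldNormedType.Exports.
Local Open Scope classical_set_scope.
Local Open Scope ring_scope.

Section NearDiff.
Context {R : realType} {V W : normedModType R}.

Lemma near_eq_diff (f g : V -> W) (x : V) :
  (\forall y \near x, f y = g y) -> differentiable f x ->
  differentiable g x /\ 'd g x = 'd f x :> (V -> W).
Proof.
move=> fg df.
have gx : g x = f x by have /nbhs_singleton := fg.
have H : g \o shift x = cst (g x) + 'd f x +o_ 0 id.
  apply/eqaddoP => e e0.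
  have /eqaddoP/(_ e e0) Hf := diff_locally df.
  have fg0 : \forall y \near (0 : V), f (y + x) = g (y + x).
    by move: fg; rewrite (near_shift 0 x) /= subr0.
  apply: filterS2 fg0 Hf => y fgy; rewrite gx.
  by rewrite -[X in `|X| <= _ -> _]/(f (y + x) - (f x + 'd f x y)) fgy.
have dgf := diff_unique (diff_continuous df) H.
split; last exact: dgf.
by apply/diff_locallyP; rewrite dgf; split; [exact: diff_continuous|exact: H].
Qed.
End NearDiff.

Section Smooth.
Context {R : realType}.

(* C^k on an open set U of R^n: all iterated directional derivatives of order
   <= k exist on U and are continuous there (only used with finite-dimensional
   V). *)
Section def.
Context {V W : normedModType R}.

Fixpoint Ck (k : nat) (U : set V) (f : V -> W) : Prop :=
  if k is k'.+1 then
    (forall x, U x -> differentiable f x) /\ (forall v, Ck k' U ('D_v f))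
  else forall x, U x -> {for x, continuous f}.

Definition smooth_on (U : set V) (f : V -> W) := forall k, Ck k U f.
End def.

Section lemmas.
Context {V W : normedModType R}.
Implicit Types (U : set V) (f g : V -> W).

Lemma Ck_sub k U U' f : U' `<=` U -> Ck k U f -> Ck k U' f.
Proof.
move=> UU; elim: k f => [|k IH] f /=; first by move=> H x /UU/H.
by move=> [d D]; split=> [x /UU/d//|v]; exact/IH.
Qed.

Lemma Ck_le k U f : Ck k.+1 U f -> Ck k U f.
Proof.
elim: k f => [|k IH] f; first by move=> [d _] x /d/differentiable_continuous.
by move=> [d D]; split=> // v; exact/IH.
Qed.

Lemma Ck_ext k U f g : open U -> (forall x, U x -> f x = g x) ->
  Ck k U f -> Ck k U g.
Proof.
move=> oU; elim: k f g => [|k IH] f g fg.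
  move=> H x Ux; rewrite /prop_for /continuous_at -fg//.
  apply: cvg_trans (H _ Ux); apply: near_eq_cvg.
  by near=> y; apply: fg; near: y; exact: open_nbhs_nbhs.
have nfg x : U x -> \forall y \near x, f y = g y.
  by move=> Ux; near=> y; apply: fg; near: y; exact: open_nbhs_nbhs.
move=> [d D]; split=> [x Ux|v].
  by have [] := near_eq_diff (nfg _ Ux) (d _ Ux).
apply: IH (D v) => x Ux.
have [dg e] := near_eq_diff (nfg _ Ux) (d _ Ux).
have ev : 'd g x v = 'd f x v by rewrite -[LHS]/(('d g x : V -> W) v) e.
exact: (etrans (deriveE v (d _ Ux)) (etrans (esym ev) (esym (deriveE v dg)))).
Unshelve. all: by end_near. Qed.

Lemma Ck_cst k U (c : W) : Ck k U (cst c).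
Proof.
elim: k c => [|k IH] c /=; first by move=> x _; exact: cst_continuous.
split=> [x _|v]; first exact: differentiable_cst.
rewrite (_ : 'D_v (cst c) = cst 0)//; apply/funext => x.
by rewrite derive_cst.
Qed.

Lemma Ck_lin k U (l : {linear V -> W}) : continuous l -> Ck k U l.
Proof.
move=> cl; case: k => [|k] /=; first by move=> x _; exact: cl.
split=> [x _|v]; first exact: linear_differentiable.
rewrite (_ : 'D_v l = cst (l v)); first exact: Ck_cst.
by apply/funext => x; rewrite deriveE ?diff_lin//; exact: linear_differentiable.
Qed.

Lemma Ck_add k U f g : open U -> Ck k U f -> Ck k U g -> Ck k U (f + g).
Proof.
move=> oU; elim: k f g => [|k IH] f g.
  by move=> cf cg x Ux; apply: continuousD; [exact: cf|exact: cg].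
move=> [df Df] [dg Dg]; split=> [x Ux|v].
  by apply: differentiableD; [exact: df|exact: dg].
apply: Ck_ext oU _ (IH _ _ (Df v) (Dg v)) => x Ux.
by rewrite deriveD//; apply: diff_derivable; [exact: df|exact: dg].
Qed.

Lemma Ck_sum k U n (f : 'I_n -> V -> W) : open U -> (forall i, Ck k U (f i)) ->
  Ck k U (\sum_i f i).
Proof.
move=> oU H; apply: (@big_ind _ (fun g => Ck k U g)) => //.
  exact: Ck_cst.
by move=> ? ?; exact: Ck_add.
Qed.
End lemmas.

Lemma fst_continuous (V V' : normedModType R) : continuous (fst : V * V' -> V).
Proof. by move=> [p q]; exact: cvg_fst. Qed.

Lemma open_cylinder (V V' : normedModType R) (U : set V) :
  open U -> open (U `*` [set: V']).
Proof.
move=> oU; rewrite (_ : _ `*` _ = fst @^-1` U); last first.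
  by apply/seteqP; split => -[x y] /=; [case|].
by apply: open_comp => // p _; exact: fst_continuous.
Qed.

Lemma Ck_fst k (V V' W : normedModType R) (U : set V) (f : V -> W) :
  Ck k U f -> Ck k (U `*` [set: V']) (f \o fst).
Proof.
elim: k f => [|k IH] f.
  move=> cf [x y] [/= Ux _]; apply: (@continuous_comp _ _ _ fst f).
    exact: fst_continuous.
  exact: cf.
move=> [df Df]; split=> [[x y] [/= Ux _]|[a b]].
  apply: (@differentiable_comp _ _ _ _ (fst : V * V' -> V) f).
    apply: linear_differentiable; exact: fst_continuous.
  exact: df.
rewrite (_ : 'D_(a, b) _ = 'D_a f \o fst); first exact: (IH _ (Df a)).
by apply/funext => -[x y].
Qed.

Lemma scale_is_bilinear (W : normedModType R) :
  bilinear_for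
    (GRing.Scale.Law.clone _ _ *:%R _) (GRing.Scale.Law.clone _ _ *:%R _)
    (@GRing.scale R W).
Proof.
split=> [u'|u] a x y /=.
- by rewrite scalerDl scalerA.
- by rewrite scalerDr !scalerA mulrC.
Qed.
HB.instance Definition _ (W : normedModType R) :=
  bilinear_isBilinear.Build R R W W _ _ (@GRing.scale R W) (scale_is_bilinear W).

Lemma Ck_scale k (V W : normedModType R) (U : set V) (s : V -> R) (f : V -> W) :
  open U -> Ck k U s -> Ck k U f -> Ck k U (fun x => s x *: f x).
Proof.
move=> oU; elim: k s f => [|k IH] s f.
  by move=> cs cf x Ux; apply: continuousZ; [exact: cs|exact: cf].
move=> Cs Cf; have [ds Ds] := Cs; have [df Df] := Cf.
have cb : continuous (fun p : R * W => p.1 *: p.2).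
  by move=> p; exact: scale_continuous.
have dp x : U x -> differentiable (fun y => (s y, f y)) x.
  by move=> Ux; apply: differentiable_pair; [exact: ds|exact: df].
have db (p : R * W) := @differentiable_bilin _ _ _ _ (@GRing.scale R W) p cb.
have dsf x : U x -> differentiable (fun x => s x *: f x) x.
  move=> Ux; apply: (@differentiable_comp _ _ _ _ (fun y => (s y, f y))
    (fun p : R * W => p.1 *: p.2)); [exact: dp|exact: db].
split=> [//|v].
have H := Ck_add oU (IH _ _ (Ck_le Cs) (Df v)) (IH _ _ (Ds v) (Ck_le Cf)).
apply: Ck_ext oU _ H => x Ux.
rewrite [RHS]deriveE; last exact: dsf.
rewrite -[RHS]/('d ((fun p : R * W => p.1 *: p.2) \o (fun y => (s y, f y))) x v).
rewrite diff_comp; [|exact: dp|exact: db].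
rewrite /= diff_pair; [|exact: ds|exact: df].
rewrite (@diff_bilin _ _ _ _ (@GRing.scale R W)) //=.
by rewrite -(deriveE v (df _ Ux)) -(deriveE v (ds _ Ux)).
Qed.

Lemma Ck_pair k (V W W' : normedModType R) (U : set V) (f : V -> W) (g : V -> W') :
  open U -> Ck k U f -> Ck k U g -> Ck k U (fun x => (f x, g x)).
Proof.
move=> oU; elim: k f g => [|k IH] f g.
  by move=> cf cg x Ux; apply: cvg_pair; [exact: cf|exact: cg].
move=> [df Df] [dg Dg].
have dfg x : U x -> differentiable (fun y => (f y, g y)) x.
  by move=> Ux; apply: differentiable_pair; [exact: df|exact: dg].
split=> // v; apply: Ck_ext oU _ (IH _ _ (Df v) (Dg v)) => x Ux.
by rewrite [RHS]deriveE ?diff_pair ?deriveE//; first [exact: dfg|exact: df|exact: dg].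
Qed.

(* The tangent map of a smooth map is smooth; this makes the induced charts of
   the tangent bundle compatible. *)
Lemma smooth_tangent n (U : set 'rV[R]_n) (f : 'rV[R]_n -> 'rV[R]_n) :
  open U -> smooth_on U f ->
  smooth_on (U `*` [set: 'rV[R]_n]) (fun p : 'rV[R]_n * 'rV[R]_n => (f p.1, 'd f (p.1) p.2)).
Proof.
move=> oU sf k.
have oUT := @open_cylinder _ 'rV[R]_n _ oU.
apply: Ck_pair => //; first exact: (@Ck_fst k _ 'rV[R]_n _ U f (sf k)).
pose h (i : 'I_n) (p : 'rV[R]_n * 'rV[R]_n) := p.2 0 i *: 'D_('e_i) f p.1.
apply: (Ck_ext (f := \sum_i h i)) => //; last first.
  apply: Ck_sum => // i; apply: Ck_scale => //; last exact: (@Ck_fst k _ 'rV[R]_n _ U ('D_('e_i) f) ((sf k.+1).2 _)).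
  have lc : linear (fun p : 'rV[R]_n * 'rV[R]_n => p.2 0 i : R).
    by move=> a [? ?] [? ?] /=; rewrite !mxE.
  pose lM := GRing.isLinear.Build _ _ _ _ _ lc.
  pose l : {linear _ -> _} := HB.pack (fun p : 'rV[R]_n * 'rV[R]_n => p.2 0 i : R) lM.
  apply: (Ck_lin k _ (l := l)) => p /=.
  apply: (@continuous_comp _ _ _ snd (fun u : 'rV[R]_n => u 0 i)).
    by case: p => a b; exact: cvg_snd.
  exact: coord_continuous.
move=> [x u] [/= Ux _]; rewrite fct_sumE /h/=.
have [df _] := sf 1%N.
rewrite {2}(row_sum_delta u) linear_sum /=; apply: eq_bigr => i _.
by rewrite linearZ/= deriveE//; exact: df.
Qed.

End Smooth.

(* A smooth atlas on T modelled on E, where E is R^n, or R^n x R^n for a tangent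
   bundle.  [param c] is meaningful only on the image of the chart c. *)
Record atlas (R : realType) (E : normedModType R) (T : Type) := Atlas {
  chart : Type;
  dom : chart -> set T;
  coord : chart -> T -> E;
  param : chart -> E -> T;
  chart_cover : forall p, exists c, dom c p;
  coordK : forall c p, dom c p -> param c (coord c p) = p;
  overlap_open : forall c d, open (coord c @` (dom c `&` dom d));
  overlap_smooth : forall c d,
    smooth_on (coord c @` (dom c `&` dom d)) (coord d \o param c) }.

Section Tangent.
Context {R : realType} {E : normedModType R} {T : Type} (A : atlas E T).
Implicit Types (p : T) (c d : chart A).

Definition trans c d : E -> E := coord d \o param c.

Definition chart_at p : chart A := projT1 (cid (chart_cover A p)).

Lemma chart_atP p : dom (chart_at p) p.
Proof. exact: projT2 (cid (chart_cover A p)). Qed.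

(* A tangent vector at p is a family of components X c in E, one for each chart
   c around p, transforming by the Jacobians of the transition maps; the
   components in charts not containing p are 0 by convention. *)
Definition components p : {pred (chart A -> E)} := fun X => `[<
  (forall c, ~ dom c p -> X c = 0) /\
  (forall c d, dom c p -> dom d p -> X d = 'd (trans c d) (coord c p) (X c)) >].

Lemma components_submod_closed p : submod_closed (components p).
Proof.
split; first by apply/asboolP; split => // c d _ _; rewrite /= linear0.
move=> a X Y /asboolP[X0 XE] /asboolP[Y0 YE]; apply/asboolP; split => [c pc|c d pc pd].
  by rewrite /= -[LHS]/(a *: X c + Y c) X0// Y0// scaler0 addr0.
by rewrite -[LHS]/(a *: X d + Y d) -[(_ + _) c]/(a *: X c + Y c) linearP -XE// -YE.
Qed.

HB.instance Definition _ p :=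
  GRing.isSubmodClosed.Build R (chart A -> E) (components p)
    (components_submod_closed p).

Record tangent p := Tangent {
  tcomp :> chart A -> E; tcompP : tcomp \in components p }.

HB.instance Definition _ p := [isSub for @tcomp p].
HB.instance Definition _ p := [Choice of tangent p by <:].
HB.instance Definition _ p := [SubChoice_isSubLmodule of tangent p by <:].

Lemma tangentD p (X Y : tangent p) c : (X + Y) c = X c + Y c.
Proof. by []. Qed.

Lemma tangentZ p (X : tangent p) a c : (a *: X) c = a *: X c.
Proof. by []. Qed.

Lemma tangent_trans p (X : tangent p) c d : dom c p -> dom d p ->
  X d = 'd (trans c d) (coord c p) (X c).
Proof. by have /asboolP[_ +] := tcompP X; exact. Qed.

Lemma tangent_eq p (X Y : tangent p) c : dom c p -> X c = Y c -> X = Y.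
Proof.
move=> pc XY; apply: val_inj; apply/funext => d /=.
have [pd|npd] := pselect (dom d p); first by rewrite !(tangent_trans _ pc pd) XY.
have /asboolP[X0 _] := tcompP X; have /asboolP[Y0 _] := tcompP Y.
by rewrite X0// Y0.
Qed.

(* The tangent vector at p with components w in the chart c (see tangent_ofE). *)
Definition tangent_of c p (w : E) : tangent p := xget 0 [set X : tangent p | X c = w].

Lemma near_overlap c d p : dom c p -> dom d p ->
  \forall x \near coord c p, (coord c @` (dom c `&` dom d)) x.
Proof.
move=> pc pd; apply: open_nbhs_nbhs; split; first exact: overlap_open.
by exists p.
Qed.

Lemma trans_diff c d p : dom c p -> dom d p ->
  differentiable (trans c d) (coord c p).
Proof.
move=> pc pd; apply: (overlap_smooth c d 1%N).1.
by exists p.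
Qed.

Lemma trans_cocycle c d e p w : dom c p -> dom d p -> dom e p ->
  'd (trans c e) (coord c p) w =
  'd (trans d e) (coord d p) ('d (trans c d) (coord c p) w).
Proof.
move=> pc pd pe.
have dcd := trans_diff pc pd.
have etr : trans c d (coord c p) = coord d p by rewrite /trans /= coordK.
have dde : differentiable (trans d e) (trans c d (coord c p)).
  by rewrite etr; exact: trans_diff.
have near_eq : \forall x \near coord c p, (trans d e \o trans c d) x = trans c e x.
  apply: filterS (near_overlap pc pd) => _ [q [qc qd] <-].
  by rewrite /trans /= coordK// coordK.
have [_ ->] := near_eq_diff near_eq (differentiable_comp dcd dde).
by rewrite diff_comp//= etr.
Qed.

Lemma trans_id c p w : dom c p -> 'd (trans c c) (coord c p) w = w.
Proof.
move=> pc.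
have near_eq : \forall x \near coord c p, id x = trans c c x.
  apply: filterS (near_overlap pc pc) => _ [q [qc _] <-].
  by rewrite /trans /= coordK.
have di : differentiable (id : E -> E) (coord c p) by exact: ex_diff.
have [_ ->] := near_eq_diff near_eq di.
by rewrite diff_val.
Qed.

Lemma tangent_ofE c p w : dom c p -> tangent_of c p w c = w.
Proof.
move=> pc; rewrite /tangent_of.
pose X d := if pselect (dom d p) then 'd (trans c d) (coord c p) w else 0.
have XP : X \in components p.
  apply/asboolP; split => [d npd|d e pd pe]; rewrite /X; first by case: pselect.
  by case: pselect => // ?; case: pselect => // ?; exact: trans_cocycle.
apply: (@xgetI _ 0 [set Y : tangent p | Y c = w] (Tangent XP)) => /=.
by rewrite /X; case: pselect => // ?; exact: trans_id.
Qed.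

Definition smooth_fun (f : T -> R) :=
  forall c, smooth_on (coord c @` dom c) (f \o param c).

Definition one_form := forall p, tangent p -> R.

(* Computed in one chart around p; chart-independent for smooth f. *)
Definition differential (f : T -> R) : one_form := fun p X =>
  let c := chart_at p in 'd (f \o param c) (coord c p) (X c).

Definition smooth_form (theta : one_form) :=
  (forall p, linear (theta p : tangent p -> R)) /\
  (forall c w, smooth_on (coord c @` dom c)
                 (fun x => theta (param c x) (tangent_of c (param c x) w))).

(* (d theta)(X, Y) = (d_i theta_j)(X^i Y^j - X^j Y^i), without a factor 1/2,
   computed in one chart around p; chart-independent for smooth theta. *)
Definition ext_diff (theta : one_form) p (X Y : tangent p) : R :=
  let c := chart_at p in
  let theta_ w x := theta (param c x) (tangent_of c (param c x) w) in
  'D_(X c) (theta_ (Y c)) (coord c p) - 'D_(Y c) (theta_ (X c)) (coord c p).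

(* T_p M for a subset M: velocities at p of smooth curves contained in M. *)
Definition tangent_space (M : set T) p : set (tangent p) :=
  [set X | exists c, dom c p /\ exists (gamma : R -> T) (e : R),
     [/\ 0 < e, gamma 0 = p,
         forall t, `|t| < e -> dom c (gamma t) /\ M (gamma t),
         smooth_on [set t : R | `|t| < e] (coord c \o gamma) &
         X c = derive1 (coord c \o gamma) 0]].

End Tangent.
Arguments differential {R E T} A f p X.
Arguments ext_diff {R E T A} theta p X Y.
Arguments tangent_space {R E T} A M p.

Section Span.
Context {R : realType} {V : lmodType R}.

Definition lincombs k (b : 'I_k -> V) : set V :=
  [set v | exists a : 'I_k -> R, v = \sum_i a i *: b i].

(* S is a linear subspace of dimension k. *)
Definition has_dim (S : set V) (k : nat) := exists b : 'I_k -> V,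
  (forall a : 'I_k -> R, \sum_i a i *: b i = 0 -> forall i, a i = 0) /\
  S = lincombs b.
End Span.

Section TangentBundle.
Context {R : realType} {n : nat} {T : Type} (A : atlas 'rV[R]_n T).

Definition tbundle := {q : T & tangent A q}.

Definition tdom (c : chart A) : set tbundle := [set v | dom c (tag v)].
(* The induced coordinates (q^i, dq^i/dt) on the tangent bundle. *)
Definition tcoord (c : chart A) (v : tbundle) : 'rV[R]_n * 'rV[R]_n :=
  (coord c (tag v), tagged v c).
Definition tparam (c : chart A) (x : 'rV[R]_n * 'rV[R]_n) : tbundle :=
  Tagged (tangent A) (tangent_of c (param c x.1) x.2).

Lemma tcover v : exists c, tdom c v.
Proof. exact: chart_cover. Qed.

Lemma tcoordK c v : tdom c v -> tparam c (tcoord c v) = v.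
Proof.
case: v => q v; rewrite /tdom /tparam /tcoord /= => qc.
rewrite coordK//; congr existT.
by apply: (tangent_eq qc); rewrite tangent_ofE.
Qed.

Lemma toverlap c d : tcoord c @` (tdom c `&` tdom d) =
  (coord c @` (dom c `&` dom d)) `*` setT.
Proof.
apply/seteqP; split => [_ [[q v] /= [qc qd] <-]|[_ u] /= [[q [qc qd] <-] _]].
  by split => //=; exists q.
by exists (Tagged (tangent A) (tangent_of c q u)) => //=; rewrite /tcoord /= tangent_ofE.
Qed.

Lemma toverlap_open c d : open (tcoord c @` (tdom c `&` tdom d)).
Proof. by rewrite toverlap; apply: open_cylinder; exact: overlap_open. Qed.

Lemma toverlap_smooth c d : smooth_on (tcoord c @` (tdom c `&` tdom d))
  (tcoord d \o tparam c).
Proof.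
rewrite toverlap => k; have oU := overlap_open c d.
have oUT := @open_cylinder R _ 'rV[R]_n _ oU.
apply: (Ck_ext oUT _ (smooth_tangent oU (overlap_smooth c d) k)).
move=> [_ u] /= [[q [qc qd] <-] _].
by rewrite /tcoord /= coordK// (tangent_trans _ qc qd) tangent_ofE.
Qed.

Definition tatlas : atlas ('rV[R]_n * 'rV[R]_n)%type tbundle :=
  Atlas tcover tcoordK toverlap_open toverlap_smooth.
End TangentBundle.

Record manifold (R : realType) (n : nat) := Manifold {
  mspace :> topologicalType;
  matlas :> atlas 'rV[R]_n mspace;
  mdom_open : forall c, open (dom (a := matlas) c);
  mcoord_continuous : forall c q, dom (a := matlas) c q ->
    {for q, continuous (coord c)};
  mparam_continuous : forall c q, dom (a := matlas) c q ->
    {for coord c q, continuous (param (a := matlas) c)};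
  mhausdorff : hausdorff_space mspace;
  msecond_countable : @second_countable mspace }.

Section Mechanics.
Context {R : realType} {n : nat} (Q : manifold R n).

Record metric := Metric {
  metric_fun :> forall q : Q, tangent Q q -> tangent Q q -> R;
  metricC : forall q (X Y : tangent Q q), metric_fun X Y = metric_fun Y X;
  metric_linear : forall q (X : tangent Q q),
    linear (metric_fun X : tangent Q q -> R);
  metric_pos : forall q (X : tangent Q q), X != 0 -> 0 < metric_fun X X;
  metric_smooth : forall c u w, smooth_on (coord c @` dom c)
    (fun x => metric_fun (tangent_of (A := Q) c (param c x) u)
                         (tangent_of c (param c x) w)) }.
Arguments metric_fun g q : rename.

Local Notation TQ := (tbundle Q).
Local Notation TTQ := (tangent (tatlas Q)).
Local Notation d := (differential (tatlas Q)).

Definition flat (g : metric) q (X : tangent Q q) : tangent Q q -> R := g q X.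
(* The vector field X with flat X = f; it exists and is unique because g is
   positive definite and the tangent spaces are finite-dimensional. *)
Definition sharp (g : metric) (f : one_form Q) q : tangent Q q :=
  xget 0 [set X | flat g X = f q].

(* X^i d/dq^i |-> X^i d/d(qdot^i), and J = dq^i (x) d/d(qdot^i); both are
   chart-independent. *)
Definition vlift (v : TQ) (X : tangent Q (tag v)) : TTQ v :=
  let c := chart_at Q (tag v) in tangent_of (A := tatlas Q) c v (0, X c).
Arguments vlift : clear implicits.

Definition vert_endo (v : TQ) (X : TTQ v) : TTQ v :=
  let c := chart_at Q (tag v) in tangent_of (A := tatlas Q) c v (0, (X c).1).

Definition Jstar (theta : one_form (tatlas Q)) : one_form (tatlas Q) :=
  fun v X => theta v (vert_endo X).
Arguments Jstar : clear implicits.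

Definition mech_lagrangian (g : metric) (V : Q -> R) (v : TQ) : R :=
  2^-1 * g (tag v) (tagged v) (tagged v) - V (tag v).

(* The field qdot^i d/d(qdot^i) has value [vlift v v] at v. *)
Definition energy (L : TQ -> R) (v : TQ) : R :=
  d L v (vlift v (tagged v)) - L v.

Definition omega (L : TQ -> R) (v : TQ) (X Y : TTQ v) : R :=
  - ext_diff (Jstar (d L)) v X Y.
Arguments omega : clear implicits.

Definition hatf (f : one_form Q) (v : TQ) : R := f (tag v) (tagged v).

Definition zero_set m (phi : 'I_m -> TQ -> R) : set TQ :=
  [set v | forall a, phi a v = 0].

Definition regular_along_zeros m (phi : 'I_m -> TQ -> R) :=
  forall v, zero_set phi v -> forall y : 'I_m -> R,
    exists X : TTQ v, forall a, d (phi a) v X = y a.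

Definition lift_span m (Y : 'I_m -> forall q : Q, tangent Q q) (v : TQ) :
  set (TTQ v) := lincombs (fun a => vlift v (Y a (tag v))).

Definition transversal_along (M : set TQ) (F : forall v : TQ, set (TTQ v)) :=
  forall v, M v ->
    (forall X : TTQ v, exists X1 X2 : TTQ v,
       [/\ tangent_space (tatlas Q) M v X1, F v X2 & X = X1 + X2]) /\
    (exists d1 d2 : nat, [/\ has_dim (tangent_space (tatlas Q) M v) d1,
       has_dim (F v) d2 & has_dim [set: TTQ v] (d1 + d2)]).

Definition euler_lagrange_field (L : TQ -> R) (G : forall v : TQ, TTQ v) :=
  forall v, omega L v (G v) = d (energy L) v.

(* i_Gamma omega_L - dE_L lies in J^* F^o and Gamma lies in TM, at every point
   of M; the values of Gamma off M are irrelevant. *)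
Definition constrained_field m (L : TQ -> R) (f : 'I_m -> one_form Q)
    (M : set TQ) (Gamma : forall v : TQ, TTQ v) :=
  forall v, M v ->
    lincombs (fun a => Jstar (d (hatf (f a))) v)
      (omega L v (Gamma v) - d (energy L) v) /\
    tangent_space (tatlas Q) M v (Gamma v).

Section Projections.
Context {m : nat}.
Variables (phi : 'I_m -> TQ -> R) (Y : 'I_m -> forall q : Q, tangent Q q).

(* C^{ab} = (Y^b)^V(phi^a); its inverse matrix is (C_{ab}). *)
Definition Cmx (v : TQ) : 'M[R]_m :=
  \matrix_(a, b) d (phi a) v (vlift v (Y b (tag v))).

Definition Qproj (v : TQ) (X : TTQ v) : TTQ v :=
  \sum_a \sum_b
    (invmx (Cmx v) a b * d (phi b) v X) *: vlift v (Y a (tag v)).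

Definition Pproj (v : TQ) (X : TTQ v) : TTQ v := X - Qproj X.
End Projections.
End Mechanics.
Arguments metric_fun {R n Q} g q X Y : rename.
Arguments vlift {R n Q} v X : rename.
Arguments Jstar {R n Q} theta v X : rename.
Arguments omega {R n Q} L v X Y : rename.
Arguments Cmx {R n Q m} phi Y v : rename.
Arguments Qproj {R n Q m} phi Y v X : rename.
Arguments Pproj {R n Q m} phi Y v X : rename.

(* Main.v *)
From HB Require Import structures.
Require Import Defs.
From mathcomp Require Import all_boot all_order all_algebra.
From mathcomp Require Import boolp classical_sets functions reals topology normedtype.
From mathcomp Require Import derive ring.
Set Implicit Arguments.
Unset Strict Implicit.
Unset Printing Implicit Defensive.
Import Defs.
Import Order.TTheory GRing.Theory Num.Theory.
Import numFieldNormedType.Exports.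
Local Open Scope ring_scope.
Local Open Scope classical_set_scope.

(** * Why the projection formula holds

    Write [omega] for the Lagrangian two-form and [Y^V] for the vertical lift
    of a vector field [Y] on [Q].  In the coordinates of a chart, with
    [x = q], [u = qdot], and the momentum [p_w (x, u) = g_x (u, w)], the form
    [J^* dL] takes the value [p_w] on a tangent vector with first component
    [w] ([Jstar_lagrangian]); here only the kinetic energy contributes, since
    [J] produces vertical vectors.  Two consequences carry the proof.

    - [omega] is nondegenerate ([omega_inj]): pairing with vertical vectors
      detects the first component of a tangent vector, and once this vanishes,
      pairing with the remaining vectors detects the second, both because the
      metric is positive definite.
    - [omega (Y^V, .) = - J^* (d hatf)] when [Y] is the metric dual of [f]
      ([omega_vlift_sharp]): both sides are, up to sign, the pull-back of [f].

    Since [omega (G, .) = dE_L], the vectors [X] for which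
    [omega (X, .) - dE_L] is in the span of the [J^* (d hatf^a)] are therefore
    exactly the [G - x_a (Y^a)^V] ([omega_reaction], [omega_inj]), and it remains to see
    which of these are tangent to the zero set [M] of [phi].

    Tangent vectors of [M] are annihilated by [d phi], by the chain rule.
    Regularity makes [d phi] onto, and by transversality it is already onto on
    the span of the [(Y^a)^V]; hence the matrix [C] is invertible
    ([Cmx_unit]).  Conversely, if [d phi] annihilates [X = X1 + x_a (Y^a)^V],
    with [X1] tangent to [M], then [C x = 0], so [X = X1] is tangent to [M].
    Thus the tangent space of [M] is the kernel of [d phi]
    ([dphi_tangent_space]), with no recourse to the implicit function theorem.
    The condition [d phi (G - x_a (Y^a)^V) = 0] reads [C x = d phi (G)], and
    its unique solution is the projection [P (G)].

    The differential, the vertical lift, [J] and the exterior derivative are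
    each computed in a chart selected at the point, so that most of the work
    on the tangent bundle consists in moving these objects to a common
    chart. *)

(** * Linear algebra in coordinates *)

Section LinearAlgebra.
Context {R : realType}.

Lemma linear_delta n (h : 'rV[R]_n -> R) w :
  linear h -> h w = \sum_j w 0 j * h 'e_j.
Proof.
move=> hl; pose lM := GRing.isLinear.Build _ _ _ _ _ hl.
pose l : {linear _ -> _} := HB.pack h lM.
rewrite [in LHS](row_sum_delta w) -[LHS]/(l _) linear_sum.
by apply: eq_bigr => j _; rewrite linearZ.
Qed.

(** A surjective matrix has no left kernel: a row [k] with [k C = 0]
    annihilates every column [C x], hence every basis vector. *)
Lemma surjective_unitmx m (C : 'M[R]_m) :
  (forall y : 'cV[R]_m, exists x, C *m x = y) -> C \in unitmx.
Proof.
move=> Csurj; rewrite -row_free_unit -kermx_eq0; apply/eqP/row_matrixP => i.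
rewrite row0; apply/rowP => j; rewrite [RHS]mxE.
have [x xE] := Csurj (delta_mx j 0).
have := congr1 (mulmx (row i (kermx C))) xE.
rewrite mulmxA -row_mul mulmx_ker row0 mul0mx => /matrixP/(_ 0 0).
rewrite !mxE (bigD1 j)//= big1 ?addr0; last first.
  by move=> k kj; rewrite !mxE (negPf kj) mulr0.
by rewrite !mxE !eqxx mulr1.
Qed.

(** The matrix of a nondegenerate form has no left kernel, hence is
    invertible.  For the metric in a chart this gives the vector dual to a
    one-form at a point. *)
Lemma nondegenerate_surjective n (b : 'rV[R]_n -> 'rV[R]_n -> R) (phi : 'rV[R]_n -> R) :
  (forall u, linear (b u)) -> (forall w, linear (b ^~ w)) -> linear phi ->
  (forall u, (forall w, b u w = 0) -> u = 0) -> exists y, b y = phi.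
Proof.
move=> bl br lphi bnd.
pose B : 'M[R]_n := \matrix_(i, j) b 'e_i 'e_j.
have BE u j : (u *m B) 0 j = b u 'e_j.
  by rewrite mxE (linear_delta u (br _)); apply: eq_bigr => i _; rewrite mxE.
have Bunit : B \in unitmx.
  rewrite -row_free_unit -kermx_eq0; apply/eqP/row_matrixP => i; rewrite row0.
  apply: bnd => w; rewrite (linear_delta w (bl _)) big1// => j _.
  by rewrite -BE -row_mul mulmx_ker row0 mxE mulr0.
exists ((\row_j phi 'e_j) *m invmx B); apply/funext => w.
rewrite (linear_delta w (bl _)) (linear_delta w lphi); apply: eq_bigr => j _.
by rewrite -BE mulmxKV// mxE.
Qed.
End LinearAlgebra.

(** * Derivatives of functions that are polynomial along fibres *)

Section Calculus.
Context {R : realType}.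

(** All vertical derivatives needed below are of functions that restrict to
    the affine line through [p] as a polynomial of degree at most two: the
    Lagrangian, the functions linear on fibres, and the transition maps of the
    tangent bundle. *)
Lemma derive_parabola (V W : normedModType R) (F : V -> W) p v y z :
  (forall h, F (h *: v + p) = F p + h *: y + h ^+ 2 *: z) -> 'D_v F p = y.
Proof.
move=> FE; apply: cvg_lim => //.
have Hc : (fun h : R => y + h *: z) @ 0^' --> y.
  rewrite -[X in _ --> X]addr0 -[X in _ --> _ + X](scale0r z).
  apply: cvgD; first exact: cvg_cst.
  by apply: cvgZr_tmp; exact: cvg_within.
apply: cvg_trans Hc; apply: near_eq_cvg.
near=> h; have h0 : h != 0 by near: h; exact: nbhs_dnbhs_neq.
apply/esym; rewrite /= FE [_ - F p]addrC -addrA addKr scalerDr !scalerA mulVf// scale1r.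
by rewrite expr2 mulrA mulVf// mul1r.
Unshelve. all: by end_near. Qed.

Lemma differentiable_fiber_sum n (E : normedModType R)
    (H : 'I_n -> E * 'rV[R]_n -> R) p :
  (forall i, differentiable (H i) p) ->
  differentiable (fun q : E * 'rV[R]_n => \sum_i q.2 0 i * H i q) p.
Proof.
move=> dH; rewrite (_ : (fun q => _) =
    \sum_i ((fun q : E * 'rV[R]_n => q.2 0 i) * H i)); last first.
  by apply/funext => q; rewrite fct_sumE; apply: eq_bigr.
apply: differentiable_sum => i; apply: differentiableM; last exact: dH.
apply: (@differentiable_comp _ _ _ _ snd (fun u : 'rV[R]_n => u 0 i)).
  apply: linear_differentiable => -[a b]; exact: cvg_snd.
exact: differentiable_coord.
Qed.

Lemma near_eq_differentiable (V W : normedModType R) (f g : V -> W) x :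
  (\forall y \near x, f y = g y) -> differentiable f x -> differentiable g x.
Proof. by move=> fg df; case: (near_eq_diff fg df). Qed.

(** A function of position and velocity which is linear in the velocity is
    the sum of its values on the basis vectors weighted by the components of
    the velocity, so differentiability in the position alone is enough. *)
Lemma differentiable_fiber_linear n (x u : 'rV[R]_n) (F : 'rV[R]_n -> 'rV[R]_n -> R) :
  (\forall y \near x, linear (F y)) ->
  (forall w, differentiable (F ^~ w) x) ->
  differentiable (fun p : 'rV[R]_n * 'rV[R]_n => F p.1 p.2) (x, u).
Proof.
move=> Fl dF.
apply: (near_eq_differentiable
  (f := fun p : 'rV[R]_n * 'rV[R]_n => \sum_i p.2 0 i * F p.1 'e_i)); last first.
  apply: differentiable_fiber_sum => i.
  apply: (@differentiable_comp _ _ _ _ fst (F ^~ 'e_i)); last exact: dF.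
  apply: linear_differentiable; exact: fst_continuous.
have : \forall p \near (x, u), linear (F p.1).
  exact: (@fst_continuous R _ _ (x, u) _ Fl).
apply: filterS => -[y w] /= lF.
by rewrite [RHS](linear_delta w lF).
Qed.
End Calculus.

(** * Independence of charts and tangent spaces of zero sets *)

Section Charts.
Context {R : realType} {E : normedModType R} {T : Type} {A : atlas E T}.

Definition differentiable_at (f : T -> R) p :=
  forall c, dom (a := A) c p -> differentiable (f \o param c) (coord c p).

Lemma open_coord_dom (c : chart A) : open (coord c @` dom c).
Proof. by have := overlap_open c c; rewrite setIid. Qed.

Lemma near_coord_dom (c : chart A) p : dom c p ->
  \forall x \near coord c p, (coord c @` dom c) x.
Proof.
by move=> pc; apply: open_nbhs_nbhs; split; [exact: open_coord_dom|exists p].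
Qed.

Lemma dom_param (c : chart A) x : (coord c @` dom c) x -> dom c (param c x).
Proof. by move=> [p pc <-]; rewrite coordK. Qed.

Lemma coord_param (c : chart A) x : (coord c @` dom c) x -> coord c (param c x) = x.
Proof. by move=> [p pc <-]; rewrite coordK. Qed.

Lemma smooth_fun_differentiable f p : smooth_fun A f -> differentiable_at f p.
Proof. by move=> sf c pc; apply: (sf c 1%N).1; exists p. Qed.

(** The chain rule for the change from the chart selected at [p] to [c]. *)
Lemma differentialE f p c (X : tangent A p) : differentiable_at f p ->
  dom c p -> differential A f p X = 'd (f \o param c) (coord c p) (X c).
Proof.
move=> df pc; rewrite /differential /=; set c0 := chart_at A p.
have pc0 : dom c0 p by exact: chart_atP.
rewrite (tangent_trans X pc pc0).
have etr : trans c c0 (coord c p) = coord c0 p by rewrite /trans /= coordK.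
have d0 : differentiable (f \o param c0) (trans c c0 (coord c p)).
  by rewrite etr; exact: df.
have dt := trans_diff pc pc0.
have near_eq : \forall x \near coord c p,
    ((f \o param c0) \o trans c c0) x = (f \o param c) x.
  apply: filterS (near_overlap pc pc0) => _ [q [qc qc0] <-].
  by rewrite /trans /= coordK// coordK.
have [_ ->] := near_eq_diff near_eq (differentiable_comp dt d0).
by rewrite diff_comp//= etr.
Qed.

Lemma differential_linear f p : linear (differential A f p).
Proof. by move=> a X Y; rewrite /differential tangentD tangentZ linearP. Qed.

HB.instance Definition _ f p := GRing.isLinear.Build _ _ _ _ (differential A f p)
  (@differential_linear f p).

Lemma tangent_of_linear c p : dom c p -> linear (tangent_of (A := A) c p).
Proof.
move=> pc a u w; apply: (tangent_eq pc).
by rewrite tangentD tangentZ !tangent_ofE.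
Qed.

Lemma tangent_of_id c p (X : tangent A p) : dom c p -> tangent_of c p (X c) = X.
Proof. by move=> pc; apply: (tangent_eq pc); rewrite tangent_ofE. Qed.

(** Along a curve in [M] the function is constantly zero, so its derivative along the velocity of the curve vanishes. *)
Lemma tangent_space_ker f (M : set T) p (X : tangent A p) :
  differentiable_at f p -> (forall q, M q -> f q = 0) ->
  tangent_space A M p X -> differential A f p X = 0.
Proof.
move=> df fM [c [pc [gamma [e [e0 g0 gM sg Xc]]]]].
have dg : differentiable (coord c \o gamma) 0.
  by apply: (sg 1%N).1 => /=; rewrite normr0.
have df0 : differentiable (f \o param c) ((coord c \o gamma) 0).
  by rewrite /= g0; exact: df.
have near0 : \forall t \near (0 : R),
    (cst 0 : R -> R) t = ((f \o param c) \o (coord c \o gamma)) t.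
  apply: filterS (nbhs0_lt e0) => t te; have [dgt Mgt] := gM t te.
  by rewrite /= coordK// fM.
rewrite (differentialE _ df pc) Xc derive1E deriveE// -g0.
have [_ E0] := near_eq_diff near0 (differentiable_cst 0 0).
have := congr1 (fun h => h 1) E0; rewrite diff_comp//= diff_cst.
by move=> ->.
Qed.
End Charts.

(** * Transition maps of the tangent bundle *)

Section TangentBundleCharts.
Context {R : realType} {n : nat} {T : Type} {A : atlas 'rV[R]_n T}.
Implicit Types (v : tbundle A) (c d : chart A).
Local Notation tA := (tatlas A).

(** Bundle projections commute with transition maps, which therefore act on
    first components through the Jacobian of the base. *)
Lemma diff_trans_fst c d v (a : 'rV[R]_n * 'rV[R]_n) :
  dom c (tag v) -> dom d (tag v) ->
  ('d (trans (A := tA) c d) (tcoord c v) a).1 =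
  'd (trans c d) (coord c (tag v)) a.1.
Proof.
move=> vc vd.
have dT := @trans_diff _ _ _ tA c d v vc vd.
have db : differentiable (trans c d) (fst (tcoord c v)) by exact: trans_diff.
have dfst (p : 'rV[R]_n * 'rV[R]_n) : differentiable fst p.
  by apply: linear_differentiable; exact: fst_continuous.
have E1 : (fst \o trans (A := tA) c d) = (trans c d \o fst).
  by apply/funext => x; rewrite /trans /=.
have diff_fst (p : 'rV[R]_n * 'rV[R]_n) : 'd fst p = fst :> (_ -> _).
  by apply: diff_lin; exact: fst_continuous.
have L : 'd (fst \o trans (A := tA) c d) (tcoord c v) a =
    ('d (trans (A := tA) c d) (tcoord c v) a).1.
  by rewrite (diff_comp dT (dfst _)) /comp diff_fst.
rewrite -L E1 (diff_comp (dfst _) db).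
by rewrite /comp diff_fst.
Qed.

(** A transition map of the tangent bundle is linear on each fibre, with the
    Jacobian of the base at the foot point as its matrix.  Hence it acts on
    vertical vectors by that Jacobian, without second derivatives of the
    change of coordinates. *)
Lemma diff_trans_vertical c d v (w : 'rV[R]_n) :
  dom c (tag v) -> dom d (tag v) ->
  'd (trans (A := tA) c d) (tcoord c v) (0, w) =
  (0, 'd (trans c d) (coord c (tag v)) w).
Proof.
move=> vc vd; rewrite -deriveE; last exact: (@trans_diff _ _ _ tA c d v vc vd).
apply: (@derive_parabola _ _ _ _ _ _ _ 0) => h; rewrite scaler0 addr0.
rewrite /trans /= /tcoord /tparam /=.
have lT := @tangent_of_linear _ _ _ A c (tag v) vc.
rewrite scaler0 add0r coordK// lT tangentD tangentZ.
rewrite (tangent_trans (tangent_of c (tag v) w) vc vd) tangent_ofE//.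
by congr pair; rewrite /= ?scaler0 ?addr0// addrC.
Qed.
End TangentBundleCharts.

(** * The metric and the vertical structure in a chart *)

Section Mechanics.
Context {R : realType} {n : nat} {Q : manifold R n}.
Implicit Types (v : tbundle Q) (c d : chart Q) (g : metric Q) (q : Q).
Local Notation tA := (tatlas Q).

Lemma vlift_chart c v (X : tangent Q (tag v)) : dom c (tag v) ->
  vlift v X c = (0, X c).
Proof.
move=> vc; have vc0 := chart_atP Q (tag v).
rewrite (@tangent_trans _ _ _ tA v _ _ c vc0 vc) /vlift.
rewrite (@tangent_ofE _ _ _ tA _ v _ vc0) diff_trans_vertical//.
by rewrite -(tangent_trans X vc0 vc).
Qed.

Lemma vert_endo_chart c v (X : tangent tA v) : dom c (tag v) ->
  vert_endo X c = (0, (X c).1).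
Proof.
move=> vc; have vc0 := chart_atP Q (tag v).
rewrite (@tangent_trans _ _ _ tA v _ _ c vc0 vc) /vert_endo.
rewrite (@tangent_ofE _ _ _ tA _ v _ vc0) diff_trans_vertical//.
by rewrite (@tangent_trans _ _ _ tA v X _ c vc0 vc) diff_trans_fst.
Qed.

HB.instance Definition _ g q (X : tangent Q q) :=
  GRing.isLinear.Build _ _ _ _ (g q X) (@metric_linear _ _ _ g q X).

(** [gram g c x u w] is [g_ij(x) u^i w^j], the metric in the chart [c].  It is
    meaningful only for [x] in the image of [c]. *)
Definition gram g c x u w :=
  g (param c x) (tangent_of (A := Q) c (param c x) u)
                (tangent_of (A := Q) c (param c x) w).

Lemma gramC g c x u w : gram g c x u w = gram g c x w u.
Proof. exact: metricC. Qed.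

Lemma gram_linear g c x u : (coord c @` dom c) x -> linear (gram g c x u).
Proof.
move=> /dom_param xc a w z; rewrite /gram.
by rewrite (@tangent_of_linear _ _ _ Q c _ xc) linearP.
Qed.

Lemma gramx0 g c x u : (coord c @` dom c) x -> gram g c x u 0 = 0.
Proof.
move=> xc; have := gram_linear g u xc (-1) 0 0.
by rewrite scaler0 addr0 scaleN1r addNr.
Qed.

Lemma gram_differentiable g c x u w : (coord c @` dom c) x ->
  differentiable (fun y => gram g c y u w) x.
Proof. by move=> xc; exact: (metric_smooth g c u w 1%N).1. Qed.

Lemma metric_eq0 g q (X : tangent Q q) : g q X X = 0 -> X = 0.
Proof.
move=> XX0; apply/eqP; apply: contraT => X0.
by have := metric_pos g X0; rewrite XX0 ltxx.
Qed.

Lemma gram_coord g c q (X Y : tangent Q q) : dom c q ->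
  gram g c (coord c q) (X c) (Y c) = g q X Y.
Proof.
move=> qc; have : param c (coord c q) = q by exact: coordK.
rewrite /gram; move: (param _ _) => q' q'E; subst q'.
by rewrite !tangent_of_id.
Qed.

(** The dual vector field is selected by a choice operator; that a candidate
    exists follows from nondegeneracy of the metric in a chart. *)
Lemma sharpE g (f : one_form Q) q (X : tangent Q q) :
  linear (f q) -> g q (sharp g f q) X = f q X.
Proof.
move=> lf.
suff [Y YE] : exists Y : tangent Q q, flat g Y = f q.
  rewrite -[LHS]/(flat g _ X).
  by have -> := @xgetPex _ (0 : tangent Q q) [set Z | flat g Z = f q] (ex_intro _ Y YE).
pose c := chart_at Q q.
have qc : dom c q := chart_atP Q q.
have lt := @tangent_of_linear _ _ _ Q c q qc.
pose b u w := g q (tangent_of (A := Q) c q u) (tangent_of (A := Q) c q w).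
have bl u : linear (b u) by move=> a w z; rewrite /b lt linearP.
have bC u w : b u w = b w u by exact: metricC.
have [|||w wE|y yE] := @nondegenerate_surjective R n b (f q \o tangent_of (A := Q) c q).
- exact: bl.
- by move=> w a u z; rewrite !(bC _ w) bl.
- by move=> a u w /=; rewrite lt lf.
- have := wE w => /metric_eq0 tw0.
  by rewrite -(@tangent_ofE _ _ _ Q c q w qc) tw0.
exists (tangent_of (A := Q) c q y); apply/funext => Z.
rewrite /flat -(@tangent_of_id _ _ _ Q c q Z qc).
by rewrite -[LHS]/(b _ _) yE.
Qed.

(** * The Lagrangian two-form *)

Section Lagrangian.
Variables (g : metric Q) (V : Q -> R).
Hypothesis V_smooth : smooth_fun Q V.
Local Notation L := (mech_lagrangian g V).

Lemma coord_image c v : dom c (tag v) -> (coord c @` dom c) (coord c (tag v)).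
Proof. by exists (tag v). Qed.

Lemma near_cylinder c v : dom c (tag v) ->
  \forall z \near tcoord c v, (coord c @` dom c) z.1.
Proof.
by move=> vc; exact: (@fst_continuous R _ _ (tcoord c v) _ (near_coord_dom vc)).
Qed.

(** Keeping one argument of the metric constant makes it linear in the other. *)
Lemma gram_fiber_differentiable c v w : dom c (tag v) ->
  differentiable (fun z : 'rV[R]_n * 'rV[R]_n => gram g c z.1 w z.2) (tcoord c v).
Proof.
move=> vc; apply: (@differentiable_fiber_linear R n _ _
  (fun y u => gram g c y w u)) => [|w'].
  by apply: filterS (near_coord_dom vc) => x xc; exact: gram_linear.
by apply: gram_differentiable; exact: coord_image.
Qed.

(** The kinetic energy is quadratic in the velocity; expanding one of the two
    arguments in the standard basis leaves coefficients linear in the velocity. *)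
Lemma lagrangian_differentiable v : differentiable_at (A := tA) L v.
Proof.
move=> c0; move: (c0 : chart Q) => c vc0; have vc : dom c (tag v) := vc0.
have dV : differentiable (fun z : 'rV[R]_n * 'rV[R]_n => V (param c z.1)) (tcoord c v).
  apply: (@differentiable_comp _ _ _ _ fst (V \o param c)).
    apply: linear_differentiable; exact: fst_continuous.
  by apply: (V_smooth c 1%N).1; exact: coord_image.
have dg : differentiable (fun z : 'rV[R]_n * 'rV[R]_n =>
    \sum_i z.2 0 i * gram g c z.1 'e_i z.2) (tcoord c v).
  by apply: differentiable_fiber_sum => i; exact: gram_fiber_differentiable.
have dK := differentiableB (differentiableZ (2^-1) dg) dV.
apply: near_eq_differentiable dK.
apply: filterS (near_cylinder vc) => -[x u] /= xc.
rewrite -[RHS]/(2^-1 * gram g c x u u - V (param c x)).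
congr (_ * _ - _).
rewrite [RHS](linear_delta u (gram_linear g u xc)).
by apply: eq_bigr => i _; rewrite gramC.
Qed.

(** The vertical derivative of the kinetic energy along [w] is the momentum
    [g (qdot, w)], and the potential is constant on fibres. *)
Lemma Jstar_lagrangian c v (X : tangent tA v) : dom c (tag v) ->
  Jstar (differential tA L) v X =
  gram g c (coord c (tag v)) (tagged v c) (X c).1.
Proof.
move=> vc; have xc := coord_image vc.
rewrite /Jstar (@differentialE _ _ _ tA L v c _ (@lagrangian_differentiable v))//.
rewrite vert_endo_chart// -deriveE; last exact: lagrangian_differentiable.
set x := coord c (tag v); set u := tagged v c; set w := (X c).1.
(* The kinetic energy along [u + h w] has quadratic term [h ^ 2 * g (w, w) / 2]. *)
apply: (@derive_parabola _ _ _ _ _ _ _ (2^-1 * gram g c x w w)) => h.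
rewrite -[Defs.coord _ _]/(x, u).
have -> : h *: (0, w) + (x, u) = (x, h *: w + u).
  by rewrite -[LHS]/(h *: 0 + x, h *: w + u) scaler0 add0r.
rewrite -[(L \o _) (x, _)]/(2^-1 * gram g c x (h *: w + u) (h *: w + u) - V (param c x)).
rewrite -[(L \o _) (x, u)]/(2^-1 * gram g c x u u - V (param c x)).
rewrite gram_linear// ![gram _ _ _ (h *: w + u) _]gramC !gram_linear//.
rewrite (gramC g c x w u) /GRing.scale /=.
by field.
Qed.

(** The function [p_w (q, qdot) = g_ij qdot^i w^j]; for [w] a basis vector it
    is the canonical momentum conjugate to that coordinate. *)
Definition momentum c w (z : 'rV[R]_n * 'rV[R]_n) := gram g c z.1 z.2 w.

Lemma momentum_differentiable c v w : dom c (tag v) ->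
  differentiable (momentum c w) (tcoord c v).
Proof.
move=> vc; rewrite (_ : momentum c w = fun z => gram g c z.1 w z.2).
  exact: gram_fiber_differentiable.
by apply/funext => z; exact: gramC.
Qed.

Lemma near_momentum c v (w : 'rV[R]_n * 'rV[R]_n) : dom c (tag v) ->
  \forall z \near tcoord c v,
    Jstar (differential tA L) (tparam c z) (tangent_of (A := tA) c (tparam c z) w)
    = momentum c w.1 z.
Proof.
move=> vc; apply: filterS (near_cylinder vc) => -[x u] /= xc.
have pc : dom c (param c x) by exact: dom_param.
have tpc : dom (a := tA) c (tparam c (x, u)) := pc.
rewrite (@Jstar_lagrangian c)// (@tangent_ofE _ _ _ tA _ _ _ tpc).
by rewrite /momentum /= coord_param// tangent_ofE.
Qed.

(** In the chart selected at [v] the form [J^* dL] is [p_i dq^i], so [omega]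
    is the wedge of [dq^i] and [dp_i]. *)
Lemma omegaE v (X Y : tangent tA v) (c : chart Q := chart_at tA v) :
  omega L v X Y = 'D_(Y c) (momentum c (X c).1) (tcoord c v)
                - 'D_(X c) (momentum c (Y c).1) (tcoord c v).
Proof.
have vc : dom (a := Q) c (tag v) := chart_atP tA v.
rewrite /omega /ext_diff opprB.
by congr (_ - _); apply: near_eq_derive; exact: near_momentum.
Qed.

Lemma omega_skew v (X Y : tangent tA v) : omega L v X Y = - omega L v Y X.
Proof. by rewrite !omegaE opprB. Qed.

(** In the first argument [omega] is differentiated on one side, where
    linearity is that of the differential, and enters through the momentum on
    the other, where it is linearity of the metric on a neighbourhood. *)
Lemma omega_linear v (Y : tangent tA v) : linear (fun X => omega L v X Y).
Proof.
move=> a X X'; rewrite !omegaE tangentD tangentZ.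
set c : chart Q := chart_at tA v; set p := tcoord c v.
have vc : dom (a := Q) c (tag v) := chart_atP tA v.
have dm w : differentiable (momentum c w) p by exact: momentum_differentiable.
have -> : 'D_(Y c) (momentum c (a *: X c + X' c).1) p =
    a *: 'D_(Y c) (momentum c (X c).1) p + 'D_(Y c) (momentum c (X' c).1) p.
  rewrite -deriveZ; last exact: diff_derivable.
  rewrite -deriveD; last 2 first.
  - by apply: derivableZ; exact: diff_derivable.
  - exact: diff_derivable.
  apply: near_eq_derive; apply: filterS (near_cylinder vc) => z zc.
  by rewrite /momentum [LHS]gram_linear.
have -> w : 'D_(a *: X c + X' c) (momentum c w) p =
    a *: 'D_(X c) (momentum c w) p + 'D_(X' c) (momentum c w) p.
  by rewrite !(deriveE _ (dm w)) linearP.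
move: ('D_(Y c) _ p) ('D_(Y c) _ p) ('D_(X c) _ p) ('D_(X' c) _ p) => s s' t t'.
by rewrite -![_ *: _]/(a * _); ring.
Qed.

(** A vertical vector has no [dq^i] component, and along it [p_w] varies
    linearly with the velocity. *)
Lemma omega_vertical v (w : 'rV[R]_n) (X Y : tangent tA v)
    (c : chart Q := chart_at tA v) :
  X c = (0, w) -> omega L v X Y = - gram g c (coord c (tag v)) w (Y c).1.
Proof.
have vc : dom (a := Q) c (tag v) := chart_atP tA v.
move=> Xc; rewrite omegaE -/c Xc /=.
have -> : 'D_(Y c) (momentum c 0) (tcoord c v) = 0.
  rewrite -[RHS](derive_cst (0 : R) (tcoord c v) (Y c)).
  apply: near_eq_derive; apply: filterS (near_cylinder vc) => z zc.
  by rewrite /momentum gramx0.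
rewrite sub0r; congr (- _).
apply: (@derive_parabola _ _ _ _ _ _ _ 0) => h.
rewrite scaler0 addr0 /momentum /= scaler0 add0r.
rewrite [gram _ _ _ (_ + _) _]gramC gram_linear; last exact: coord_image.
by rewrite addrC ![gram _ _ _ (Y c).1 _]gramC.
Qed.

(** Testing against the vertical vector with second component [(X c).1]
    kills the first component of [X]; then [X] is vertical, and testing
    against the vector with first component [(X c).2] kills the second. *)
Lemma omega_nondegenerate v (X : tangent tA v) :
  (forall Y, omega L v X Y = 0) -> X = 0.
Proof.
pose c : chart Q := chart_at tA v.
have vc : dom (a := Q) c (tag v) := chart_atP tA v.
have gram_eq0 u : gram g c (coord c (tag v)) u u = 0 -> u = 0.
  have uE := @tangent_ofE _ _ _ Q c (tag v) u vc.
  by rewrite -uE gram_coord// => /metric_eq0 ->.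
move=> X0.
have X1 : (X c).1 = 0.
  pose Y := tangent_of (A := tA) c v (0, (X c).1).
  have Yc : Y c = (0, (X c).1) by exact: (@tangent_ofE _ _ _ tA).
  have := X0 Y; rewrite omega_skew (omega_vertical _ Yc) opprK.
  exact: gram_eq0.
have XE : X c = (0, (X c).2) by rewrite [LHS]surjective_pairing X1.
have X2 : (X c).2 = 0.
  pose Y := tangent_of (A := tA) c v ((X c).2, 0).
  have Yc : Y c = ((X c).2, 0) by exact: (@tangent_ofE _ _ _ tA).
  have := X0 Y; rewrite (omega_vertical _ XE) Yc => /eqP.
  by rewrite oppr_eq0 => /eqP/gram_eq0.
by apply: (@tangent_eq _ _ _ tA v _ _ _ vc); rewrite XE X2.
Qed.

Lemma hatf_differentiable (f : one_form Q) v : smooth_form f ->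
  differentiable_at (A := tA) (hatf f) v.
Proof.
move=> [fl fs] c0; move: (c0 : chart Q) => c vc0; have vc : dom c (tag v) := vc0.
apply: (@differentiable_fiber_linear R n _ _
  (fun x u => f (param c x) (tangent_of (A := Q) c (param c x) u))) => [|w].
  apply: filterS (near_coord_dom vc) => x /dom_param xc a u w.
  by rewrite (@tangent_of_linear _ _ _ Q c _ xc) fl.
by apply: (fs c w 1%N).1; exact: coord_image.
Qed.

(** A function linear on fibres is its own vertical derivative: [J^* (d hatf)]
    is the pull-back of [f] to the tangent bundle. *)
Lemma Jstar_hatf (f : one_form Q) c v (X : tangent tA v) : smooth_form f ->
  dom c (tag v) -> Jstar (differential tA (hatf f)) v X =
  f (tag v) (tangent_of (A := Q) c (tag v) (X c).1).
Proof.
move=> sf vc; have df := @hatf_differentiable f v sf.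
rewrite /Jstar (@differentialE _ _ _ tA _ v c _ df)//.
rewrite vert_endo_chart// -deriveE; last exact: df.
set x := coord c (tag v); set u := tagged v c; set w := (X c).1.
apply: (@derive_parabola _ _ _ _ _ _ _ 0) => h; rewrite scaler0 addr0.
rewrite -[Defs.coord _ _]/(x, u).
have -> : h *: (0, w) + (x, u) = (x, h *: w + u).
  by rewrite -[LHS]/(h *: 0 + x, h *: w + u) scaler0 add0r.
rewrite /hatf /tparam /= /x coordK//.
by rewrite (@tangent_of_linear _ _ _ Q c _ vc) sf.1 addrC.
Qed.

(** The lifted vector has no [dq^i] component, so contracting it with [omega]
    leaves minus the metric product of the dual vector of [f] with first
    components; by duality this is minus the pull-back of [f]. *)
Lemma omega_vlift_sharp (f : one_form Q) v (X : tangent tA v) : smooth_form f ->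
  omega L v (vlift v (sharp g f (tag v))) X =
  - Jstar (differential tA (hatf f)) v X.
Proof.
move=> sf; pose c : chart Q := chart_at tA v.
have vc : dom (a := Q) c (tag v) := chart_atP tA v.
rewrite (omega_vertical _ (vlift_chart _ vc)) -/c (Jstar_hatf _ sf vc).
rewrite -[in LHS](@tangent_ofE _ _ _ Q c (tag v) (X c).1 vc).
by rewrite gram_coord// sharpE//; exact: sf.1.
Qed.

Lemma omega_inj v (X X' : tangent tA v) :
  omega L v X = omega L v X' -> X = X'.
Proof.
move=> XX'; apply/eqP; rewrite -subr_eq0; apply/eqP/omega_nondegenerate => Y.
rewrite -scaleN1r addrC (omega_linear Y (-1) X' X) /= XX'.
by rewrite scaleN1r addNr.
Qed.

(** This turns the dynamical condition on a one-form into one on vectors: a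
    reaction in the span of the [J^* (d hatf^a)] is accounted for by a change
    of the vector within the span of the vertical lifts. *)
Lemma omega_reaction m (f : 'I_m -> one_form Q) v (X : tangent tA v) x :
  (forall a, smooth_form (f a)) ->
  omega L v (X - \sum_a x a *: vlift v (sharp g (f a) (tag v))) =
  omega L v X + \sum_a x a *: Jstar (differential tA (hatf (f a))) v.
Proof.
move=> sf; apply/funext => Z.
pose lM := GRing.isLinear.Build _ _ _ _ _ (omega_linear Z).
pose l : {linear _ -> _} := HB.pack (fun X => omega L v X Z) lM.
rewrite -[LHS]/(l _) linearB linear_sum /= -[RHS]/(_ + (\sum_a _) Z) fct_sumE.
congr (_ + _); rewrite -sumrN; apply: eq_bigr => a _.
by rewrite -[omega _ _ _ _]/(l _) linearZ /= omega_vlift_sharp// scalerN opprK.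
Qed.
End Lagrangian.

(** * The projection onto the constraint submanifold *)

Section Projection.
Context {m : nat}.
Variables (phi : 'I_m -> tbundle Q -> R) (Y : 'I_m -> forall q : Q, tangent Q q).
Hypothesis phi_smooth : forall a, smooth_fun tA (phi a).
Hypothesis phi_regular : regular_along_zeros phi.
Local Notation M := (zero_set phi).
Hypothesis phi_transversal : transversal_along M (lift_span Y).

Definition dphi v (X : tangent tA v) : 'cV[R]_m :=
  \col_a differential tA (phi a) v X.

Lemma dphi_linear v : linear (@dphi v).
Proof. by move=> a X X'; apply/colP => b; rewrite !mxE linearP. Qed.

HB.instance Definition _ v := GRing.isLinear.Build _ _ _ _ (@dphi v) (@dphi_linear v).

Definition vlift_comb v (x : 'cV[R]_m) : tangent tA v :=
  \sum_a x a 0 *: vlift v (Y a (tag v)).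

Lemma dphi_vlift_comb v x : dphi (vlift_comb v x) = Cmx phi Y v *m x.
Proof.
rewrite /vlift_comb linear_sum; apply/colP => a; rewrite summxE mxE.
by apply: eq_bigr => b _; rewrite linearZ !mxE mulrC.
Qed.

(** The double sum hides the solution [x] of the linear system
    [C x = d phi (X)]. *)
Lemma PprojE v (X : tangent tA v) :
  Pproj phi Y v X = X - vlift_comb v (invmx (Cmx phi Y v) *m dphi X).
Proof.
congr (_ - _); apply: eq_bigr => a _; rewrite mxE scaler_suml.
by apply: eq_bigr => b _; rewrite mxE.
Qed.

Lemma tangent_space_dphi v (X : tangent tA v) :
  tangent_space tA M v X -> dphi X = 0.
Proof.
move=> XM; apply/colP => a; rewrite !mxE; apply: tangent_space_ker XM.
  exact: smooth_fun_differentiable.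
by move=> q; apply.
Qed.

Lemma transversal_split v (X : tangent tA v) : M v ->
  exists X1 x, tangent_space tA M v X1 /\ X = X1 + vlift_comb v x.
Proof.
move=> /phi_transversal[+ _] => /(_ X)[X1 [X2 [X1M [x X2E] ->]]].
exists X1, (\col_a x a); split=> //; congr (_ + _); rewrite X2E.
by apply: eq_bigr => a _; rewrite mxE.
Qed.

(** Already the span of the [(Y^a)^V] is mapped onto the full column space by
    [d phi], because its complement, the tangent space of [M], is annihilated. *)
Lemma Cmx_unit v : M v -> Cmx phi Y v \in unitmx.
Proof.
move=> Mv; apply: surjective_unitmx => y.
have [X XE] := phi_regular Mv (fun a => y a 0).
have [X1 [x [/tangent_space_dphi X1M XD]]] := transversal_split X Mv.
exists x; rewrite -dphi_vlift_comb -[LHS]add0r -X1M -linearD -XD.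
by apply/colP => a; rewrite mxE XE.
Qed.

(** Transversality supplies the vectors tangent to [M], and invertibility of
    [C] excludes a component along the [(Y^a)^V]; in this way curves in [M]
    with a given velocity need not be constructed. *)
Lemma dphi_tangent_space v (X : tangent tA v) : M v ->
  dphi X = 0 -> tangent_space tA M v X.
Proof.
move=> Mv; have [X1 [x [X1M ->]]] := transversal_split X Mv.
rewrite linearD/= (tangent_space_dphi X1M) add0r dphi_vlift_comb => Cx0.
have -> : x = 0 by rewrite -[x](mulKmx (Cmx_unit Mv)) Cx0 mulmx0.
by rewrite /vlift_comb big1 ?addr0// => a _; rewrite mxE scale0r.
Qed.

Lemma Pproj_tangent v (X : tangent tA v) : M v ->
  tangent_space tA M v (Pproj phi Y v X).
Proof.
move=> Mv; apply: dphi_tangent_space => //.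
by rewrite PprojE linearB/= dphi_vlift_comb mulKVmx ?subrr// Cmx_unit.
Qed.

(** Tangency imposes [C x = d phi (X)], and [C] is invertible. *)
Lemma Pproj_unique v (X : tangent tA v) x : M v ->
  tangent_space tA M v (X - vlift_comb v x) ->
  X - vlift_comb v x = Pproj phi Y v X.
Proof.
move=> Mv /tangent_space_dphi; rewrite linearB/= dphi_vlift_comb => /eqP.
by rewrite subr_eq0 PprojE => /eqP ->; rewrite mulKmx// Cmx_unit.
Qed.
End Projection.
End Mechanics.

Theorem proposition3 (R : realType) (n m : nat) (Q : manifold R n)
    (g : metric Q) (V : Q -> R) (f : 'I_m -> one_form Q)
    (phi : 'I_m -> tbundle Q -> R)
    (G : forall v : tbundle Q, tangent (tatlas Q) v) :
  let L := mech_lagrangian g V in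
  let Y := fun a => sharp g (f a) in
  let M := zero_set phi in
  (m < n)%N ->
  smooth_fun Q V ->
  (forall a, smooth_form (f a)) ->
  (forall a, smooth_fun (tatlas Q) (phi a)) ->
  regular_along_zeros phi ->
  transversal_along M (lift_span Y) ->
  euler_lagrange_field L G ->
  (exists Gamma, constrained_field L f M Gamma) /\
  (forall Gamma, constrained_field L f M Gamma ->
     forall v, M v ->
       Gamma v = Pproj phi Y v (G v) /\
       Pproj phi Y v (G v) =
         G v - \sum_a \sum_b (invmx (Cmx phi Y v) a b *
                 differential (tatlas Q) (phi b) v (G v)) *: vlift v (Y a (tag v))).
Proof.
move=> L Y M _ sV sf sphi reg trans_M EL.
split.
  exists (fun v => Pproj phi Y v (G v)) => v Mv; split; last exact: Pproj_tangent.
  rewrite PprojE; set x := _ *m _; exists (fun a => x a 0).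
  by rewrite (@omega_reaction _ _ _ g V sV m f v _ (fun a => x a 0))// EL addrC addKr.
move=> Gamma GammaP v Mv; split=> //.
have [[x xE] GammaM] := GammaP v Mv.
have GammaE : Gamma v = G v - vlift_comb Y v (\col_a x a).
  rewrite (_ : vlift_comb _ _ _ = \sum_a x a *: vlift v (Y a (tag v))); last first.
    by apply: eq_bigr => a _; rewrite mxE.
  apply: (@omega_inj _ _ _ g V sV); rewrite (@omega_reaction _ _ _ g V sV)// EL -xE.
  by rewrite subrKC.
by rewrite GammaE; apply: (Pproj_unique sphi reg) => //; rewrite -GammaE.
Qed.
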